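(* Let $\mathbb X$ be a virtual equipment, let $j\colon A\to E$ be a tight-cell in $\mathbb X$ and let $T$ be a $j$-monad admitting an algebra object $(u_T,\rtimes_T)$. The tight-cell $u_T\colon\mathrm{Alg}(T)\to E$ strictly creates limits.
   Context: **Virtual equipments.** A virtual double category has objects, tight-cells $f\colon A\to B$ (forming a category; both $(f;g)$ and $gf$ denote $f$ followed by $g$), loose-cells, written $p\colon X\nrightarrow Y$, and 2-cells. A 2-cell has as top a chain of loose-cells $p_1\colon A_1\nrightarrow A_0,\dots,p_n\colon A_n\nrightarrow A_{n-1}$ ($n\ge 0$), as bottom a loose-cell $q\colon B_n\nrightarrow B_0$, and as sides tight-cells $f_0\colon A_0\to B_0$, $f_n\colon A_n\to B_n$; 2-cells paste multicategorically, associatively and unitally. $p_1,\dots,p_n\Rightarrow q$ denotes a 2-cell with identity sides. A virtual equipment is a virtual double category in which: every $p\colon X\nrightarrow Y$, $f\colon Z\to Y$, $g\colon W\to X$ admit a restriction $p(f,g)\colon W\nrightarrow Z$ (2-cells with bottom $p(f,g)$ and sides $h_0,h_n$ correspond bijectively, by pasting with a cartesian 2-cell, to 2-cells with bottom $p$ and sides $(h_0;f),(h_n;g)$); and every object $A$ has a loose-identity $A(1,1)\colon A\nrightarrow A$ (with a 2-cell from the empty chain to $A(1,1)$, pasting with which gives a bijection between 2-cells whose top chain contains $A(1,1)$ at a given place and 2-cells with that entry omitted). Write $B(f,g):=B(1,1)(f,g)$. A 2-cell $f\Rightarrow g$ between parallel tight-cells into $B$ is a 2-cell from the empty chain to $B(f,g)$.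 There are composition 2-cells $B(f,g),B(g,h)\Rightarrow B(f,h)$. A tight-cell $k\colon B\to C$ induces $B(f,g)\Rightarrow C(kf,kg)$, and $(\phi;k)$ denotes the composite of $\phi\colon p_1,\dots,p_n\Rightarrow B(f,g)$ with it. For $\phi\colon E(j,e)\Rightarrow E(t,e)$, $\phi(1,x)\colon E(j,ex)\Rightarrow E(t,ex)$ denotes restriction along $x$. **Relative monads and algebras.** A $j$-monad $T=(t,\dagger,\eta)$, for $j\colon A\to E$, consists of a tight-cell $t\colon A\to E$ and 2-cells $\dagger\colon E(j,t)\Rightarrow E(t,t)$, $\eta\colon j\Rightarrow t$ such that: $\dagger$ followed by the 2-cell $E(t,t)\Rightarrow E(j,t)$ induced by $\eta$ is the identity; $\eta$ followed by $\dagger$ is the identity 2-cell on $t$; and the two 2-cells $E(j,t),E(j,t)\Rightarrow E(t,t)$, given by $(\dagger,\dagger)$ then composition, and by $\dagger$ on the second factor, then composition $E(j,t),E(t,t)\Rightarrow E(j,t)$, then $\dagger$, are equal. A $T$-algebra is a tight-cell $e\colon D\to E$ with a 2-cell $\rtimes\colon E(j,e)\Rightarrow E(t,e)$ such that $\rtimes$ followed by $E(t,e)\Rightarrow E(j,e)$ (induced by $\eta$) is the identity, and the two 2-cells $E(j,t),E(j,e)\Rightarrow E(t,e)$, given by $(\dagger,\rtimes)$ then composition, and by $\rtimes$ on the second factor, then composition $E(j,t),E(t,e)\Rightarrow E(j,e)$, then $\rtimes$, are equal. For a chain $p_1,\dots,p_n$ from $D$ (left end) to $D'$ (right end), a $(p_1,\dots,p_n)$-graded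 morphism $(e\colon D\to E,\rtimes)\to(e'\colon D'\to E,\rtimes')$ is a 2-cell $\epsilon\colon p_1,\dots,p_n\Rightarrow E(e,e')$ such that the two 2-cells $E(j,e),p_1,\dots,p_n\Rightarrow E(t,e')$, given by $\rtimes$ then composing with $\epsilon$, and by composing with $\epsilon$ then $\rtimes'$, are equal. An algebra object for $T$ is a $T$-algebra $(u_T\colon \mathrm{Alg}(T)\to E,\rtimes_T)$ such that (1) for every $T$-algebra $(e\colon D\to E,\rtimes)$ there is a unique tight-cell $\langle e\rangle\colon D\to\mathrm{Alg}(T)$ with $(\langle e\rangle;u_T)=e$ and $\rtimes_T(1,\langle e\rangle)=\rtimes$; (2) every graded $T$-algebra morphism $\epsilon\colon p_1,\dots,p_n\Rightarrow E(e,e')$ is $(\langle\epsilon\rangle;u_T)$ for a unique 2-cell $\langle\epsilon\rangle\colon p_1,\dots,p_n\Rightarrow\mathrm{Alg}(T)(\langle e\rangle,\langle e'\rangle)$. **Limits.** For $p\colon X\nrightarrow Y$ and $g\colon X\to Z$, a $p$-cone for $g$ is a tight-cell $d\colon Y\to Z$ with a 2-cell $\mu\colon p\Rightarrow Z(d,g)$. It is the ($p$-weighted) limit of $g$ if, for all chains $q_1,\dots,q_n$ ($n\ge0$) from $Z$ to $Y$, pasting with $\mu$ (and composing $Z(1,d),Z(d,g)\Rightarrow Z(1,g)$) is a bijection from 2-cells $q_1,\dots,q_n\Rightarrow Z(1,d)$ to 2-cells $q_1,\dots,q_n,p\Rightarrow Z(1,g)$. **Strict creation.** For $p\colon Y\nrightarrow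 Z$, $f\colon Y\to W$, $g\colon W\to X$, a $p$-weighted limit $(x,\mu)$ of $(f;g)$ in $X$ is strictly created by $g$ if there is a $p$-cone $(w,\mu')$ for $f$ such that $(w,\mu')$ is the unique pair with $x=(w;g)$ and $\mu=(\mu';g)$, and $(w,\mu')$ is the $p$-weighted limit of $f$. ''$u_T$ strictly creates limits'' means that for all $p\colon Y\nrightarrow Z$ and $f\colon Y\to\mathrm{Alg}(T)$, every $p$-weighted limit of $(f;u_T)$ in $E$ is strictly created by $u_T$. *)

(* Defs.v *)
Set Implicit Arguments.
Unset Strict Implicit.
Unset Printing Implicit Defensive.

(** [loose X Y] is the type of loose-cells [X -|-> Y].  A chain
    [p_1 : A_1 -|-> A_0, ..., p_n : A_n -|-> A_(n-1)] has type [chain loose A_0 A_n]: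
    it is listed from its left end [A_0] to its right end [A_n], against the
    direction of the loose-cells. *)
Inductive chain (ob : Type) (loose : ob -> ob -> Type) : ob -> ob -> Type :=
| cnil : forall A, chain loose A A
| ccons : forall A0 A1 An,
    loose A1 A0 -> chain loose A1 An -> chain loose A0 An.

Arguments cnil {ob loose A}.

Fixpoint capp ob (loose : ob -> ob -> Type) A B C
    (P : chain loose A B) : chain loose B C -> chain loose A C :=
  match P with
  | cnil => fun Q => Q
  | ccons p P' => fun Q => ccons p (capp P' Q)
  end.

(** [cell P q f0 fn] is the type of 2-cells with top [P], bottom [q], left side [f0]
    and right side [fn].  Composition of tight-cells is in diagrammatic order. *)
Record vdc_data : Type := {
  ob :> Type;
  tight : ob -> ob -> Type;
  tid : forall A, tight A A;
  tcomp : forall A B C, tight A B -> tight B C -> tight A C;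
  loose : ob -> ob -> Type;
  cell : forall A0 An B0 Bn,
    chain loose A0 An -> loose Bn B0 -> tight A0 B0 -> tight An Bn -> Type
}.

Arguments tid {_} A.
Arguments tcomp {_ A B C} f g.
Arguments loose {_} X Y.
Arguments tight {_} A B.
Arguments cell {_ A0 An B0 Bn} P q f0 fn.

Declare Scope vdc_scope.
Open Scope vdc_scope.
Notation "f ;; g" := (tcomp f g) (at level 50, left associativity) : vdc_scope.
Notation chainof X := (chain (@loose X)).
Notation "P +++ Q" := (capp P Q) (at level 60, right associativity) : vdc_scope.
Notation "[ p ]c" := (ccons p cnil) (at level 0, p at level 99) : vdc_scope.
Notation "p ::c P" := (ccons p P) (at level 60, right associativity) : vdc_scope.

(** Equality of 2-cells whose boundaries are only propositionally equal.  It is needed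
    because, for instance, [f ;; tid B] and [f], or [P +++ cnil] and [P], are not
    convertible. *)
Inductive ceq (X : vdc_data) (A0 An B0 Bn : X) (P : chainof X A0 An) (q : loose Bn B0)
    (f0 : tight A0 B0) (fn : tight An Bn) (phi : cell P q f0 fn) :
    forall (P' : chainof X A0 An) (q' : loose Bn B0) (f0' : tight A0 B0)
           (fn' : tight An Bn), cell P' q' f0' fn' -> Prop :=
| ceq_refl : ceq phi phi.

Notation "phi ~= psi" := (ceq phi psi) (at level 70, no associativity) : vdc_scope.

(** [row Q f0 fn] is the type of sequences of horizontally adjacent 2-cells whose
    bottoms form the chain [Q] and whose outer sides are [f0] and [fn]. *)
Inductive row (X : vdc_data) :
    forall A0 An B0 Bn : X, chainof X B0 Bn -> tight A0 B0 -> tight An Bn -> Type :=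
| rnil : forall (A B : X) (f : tight A B), row cnil f f
| rcons : forall (A0 A1 An B0 B1 Bn : X) (P : chainof X A0 A1) (q : loose B1 B0)
      (Q : chainof X B1 Bn) (f0 : tight A0 B0) (f1 : tight A1 B1) (fn : tight An Bn),
    cell P q f0 f1 -> row Q f1 fn -> row (q ::c Q) f0 fn.

Arguments rnil {X A B} f.

Fixpoint row_top (X : vdc_data) (A0 An B0 Bn : X) (Q : chainof X B0 Bn)
    (f0 : tight A0 B0) (fn : tight An Bn) (Phi : row Q f0 fn) : chainof X A0 An :=
  match Phi with
  | rnil _ => cnil
  | @rcons _ _ _ _ _ _ _ P _ _ _ _ _ _ Phi' => P +++ row_top Phi'
  end.

Fixpoint row_app (X : vdc_data) (A0 A1 An B0 B1 Bn : X) (Q1 : chainof X B0 B1)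
    (Q2 : chainof X B1 Bn) (f0 : tight A0 B0) (f1 : tight A1 B1) (fn : tight An Bn)
    (Phi : row Q1 f0 f1) : row Q2 f1 fn -> row (Q1 +++ Q2) f0 fn :=
  match Phi in @row _ a0 a1 b0 b1 q1 g0 g1
    return forall Q : chainof X b1 Bn, row Q g1 fn -> row (q1 +++ Q) g0 fn
  with
  | rnil _ => fun _ Psi => Psi
  | rcons phi Phi' => fun _ Psi => rcons phi (row_app Phi' Psi)
  end Q2.

(** [tower R f0 g0 fn gn] is the type of two rows of 2-cells, one on top of the other:
    each 2-cell of the lower row comes with the row of 2-cells sitting above it. *)
Inductive tower (X : vdc_data) : forall A0 An B0 Bn C0 Cn : X, chainof X C0 Cn ->
    tight A0 B0 -> tight B0 C0 -> tight An Bn -> tight Bn Cn -> Type :=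
| tnil : forall (A B C : X) (f : tight A B) (g : tight B C), tower cnil f g f g
| tcons : forall (A0 A1 An B0 B1 Bn C0 C1 Cn : X) (Q : chainof X B0 B1)
      (r : loose C1 C0) (R : chainof X C1 Cn)
      (f0 : tight A0 B0) (g0 : tight B0 C0) (f1 : tight A1 B1) (g1 : tight B1 C1)
      (fn : tight An Bn) (gn : tight Bn Cn) (Phi : row Q f0 f1),
    cell Q r g0 g1 -> tower R f1 g1 fn gn -> tower (r ::c R) f0 g0 fn gn.

Arguments tnil {X A B C} f g.

Fixpoint lower (X : vdc_data) (A0 An B0 Bn C0 Cn : X) (R : chainof X C0 Cn)
    (f0 : tight A0 B0) (g0 : tight B0 C0) (fn : tight An Bn) (gn : tight Bn Cn)
    (D : tower R f0 g0 fn gn) : row R g0 gn :=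
  match D with
  | tnil _ g => rnil g
  | tcons _ psi D' => rcons psi (lower D')
  end.

Fixpoint upper (X : vdc_data) (A0 An B0 Bn C0 Cn : X) (R : chainof X C0 Cn)
    (f0 : tight A0 B0) (g0 : tight B0 C0) (fn : tight An Bn) (gn : tight Bn Cn)
    (D : tower R f0 g0 fn gn) : row (row_top (lower D)) f0 fn :=
  match D as D' in @tower _ _ _ _ _ _ _ _ k0 _ kn _
    return row (row_top (lower D')) k0 kn
  with
  | tnil f _ => rnil f
  | tcons Phi _ D' => row_app Phi (upper D')
  end.

Definition paste_op (X : vdc_data) : Type :=
  forall (A0 An B0 Bn C0 Cn : X) (Q : chainof X B0 Bn) (r : loose Cn C0)
         (f0 : tight A0 B0) (fn : tight An Bn) (g0 : tight B0 C0) (gn : tight Bn Cn)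
         (Phi : row Q f0 fn),
    cell Q r g0 gn -> cell (row_top Phi) r (f0 ;; g0) (fn ;; gn).

(** The row obtained from a tower by pasting each 2-cell of the lower row with the row
    above it. *)
Fixpoint tower_paste (X : vdc_data) (paste : paste_op X) (A0 An B0 Bn C0 Cn : X)
    (R : chainof X C0 Cn) (f0 : tight A0 B0) (g0 : tight B0 C0) (fn : tight An Bn)
    (gn : tight Bn Cn) (D : tower R f0 g0 fn gn) : row R (f0 ;; g0) (fn ;; gn) :=
  match D with
  | tnil f g => rnil (f ;; g)
  | tcons Phi psi D' => rcons (paste _ _ _ _ _ _ _ _ _ _ _ _ Phi psi)
                              (tower_paste paste D')
  end.

Fixpoint id_row_of (X : vdc_data)
    (idcell : forall (A B : X) (p : loose B A), cell [p]c p (tid A) (tid B))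
    (A0 An : X) (P : chainof X A0 An) : row P (tid A0) (tid An) :=
  match P with
  | cnil => rnil (tid _)
  | ccons p P' => rcons (idcell _ _ p) (id_row_of idcell P')
  end.

Record vdc : Type := {
  vdata :> vdc_data;
  tcompA : forall (A B C D : vdata) (f : tight A B) (g : tight B C) (h : tight C D),
    f ;; (g ;; h) = f ;; g ;; h;
  tidl : forall (A B : vdata) (f : tight A B), tid A ;; f = f;
  tidr : forall (A B : vdata) (f : tight A B), f ;; tid B = f;
  idcell : forall (A B : vdata) (p : loose B A), cell [p]c p (tid A) (tid B);
  paste : paste_op vdata;
  paste_idl : forall (A0 An B0 Bn : vdata) (P : chainof vdata A0 An) (q : loose Bn B0)
      (f0 : tight A0 B0) (fn : tight An Bn) (phi : cell P q f0 fn),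
    paste (id_row_of idcell P) phi ~= phi;
  paste_idr : forall (A0 An B0 Bn : vdata) (P : chainof vdata A0 An) (q : loose Bn B0)
      (f0 : tight A0 B0) (fn : tight An Bn) (phi : cell P q f0 fn),
    paste (rcons phi (rnil fn)) (idcell q) ~= phi;
  pasteA : forall (A0 An B0 Bn C0 Cn D0 Dn : vdata) (R : chainof vdata C0 Cn)
      (s : loose Dn D0) (f0 : tight A0 B0) (g0 : tight B0 C0) (fn : tight An Bn)
      (gn : tight Bn Cn) (h0 : tight C0 D0) (hn : tight Cn Dn)
      (D : tower R f0 g0 fn gn) (chi : cell R s h0 hn),
    paste (upper D) (paste (lower D) chi) ~= paste (tower_paste paste D) chi
}.

Arguments idcell {_ A B} p.
Arguments paste {_ A0 An B0 Bn C0 Cn Q r f0 fn g0 gn} Phi chi.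

Definition id_row (X : vdc) (A0 An : X) (P : chainof X A0 An) :
  row P (tid A0) (tid An) := id_row_of (@idcell X) P.

Definition row1 (X : vdc) (A0 A1 B0 B1 : X) (P : chainof X A0 A1) (q : loose B1 B0)
    (f0 : tight A0 B0) (f1 : tight A1 B1) (phi : cell P q f0 f1) : row [q]c f0 f1 :=
  rcons phi (rnil f1).

Definition row2 (X : vdc) (A0 A1 A2 B0 B1 B2 : X) (P1 : chainof X A0 A1)
    (P2 : chainof X A1 A2) (q1 : loose B1 B0) (q2 : loose B2 B1) (f0 : tight A0 B0)
    (f1 : tight A1 B1) (f2 : tight A2 B2)
    (phi : cell P1 q1 f0 f1) (psi : cell P2 q2 f1 f2) : row (q1 ::c [q2]c) f0 f2 :=
  rcons phi (row1 psi).

Definition vcomp (X : vdc) (A0 A1 B0 B1 C0 C1 : X) (P : chainof X A0 A1)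
    (q : loose B1 B0) (r : loose C1 C0) (f0 : tight A0 B0) (f1 : tight A1 B1)
    (g0 : tight B0 C0) (g1 : tight B1 C1) (phi : cell P q f0 f1)
    (chi : cell [q]c r g0 g1) : cell (P +++ cnil) r (f0 ;; g0) (f1 ;; g1) :=
  paste (row1 phi) chi.

(** 2-cells [p_1, ..., p_n => q]. *)
Notation gcell P q := (cell P q (tid _) (tid _)).

(** [restr p f g] is the restriction [p(f,g)]; [rfact] and [ufact] are the inverses of
    pasting with the cartesian 2-cell [cart] and with the unit 2-cell [ucell] of a
    loose-identity.  In [rfact], the sides [(h0 ; f)] and [(hn ; g)] are named [k0] and
    [kn], so that it applies to 2-cells whose sides have these composites as values
    without having them as literal expressions. *)
Record virtual_equipment : Type := {
  vcat :> vdc;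

  restr : forall X Y Z W : vcat, loose X Y -> tight Z Y -> tight W X -> loose W Z;
  cart : forall (X Y Z W : vcat) (p : loose X Y) (f : tight Z Y) (g : tight W X),
    cell [restr p f g]c p f g;
  rfact : forall (X Y Z W : vcat) (p : loose X Y) (f : tight Z Y) (g : tight W X)
      (A0 An : vcat) (P : chainof vcat A0 An) (h0 : tight A0 Z) (hn : tight An W)
      (k0 : tight A0 Y) (kn : tight An X),
    h0 ;; f = k0 -> hn ;; g = kn ->
    cell P p k0 kn -> cell P (restr p f g) h0 hn;
  rfactK : forall (X Y Z W : vcat) (p : loose X Y) (f : tight Z Y) (g : tight W X)
      (A0 An : vcat) (P : chainof vcat A0 An) (h0 : tight A0 Z) (hn : tight An W)
      (k0 : tight A0 Y) (kn : tight An X) (e0 : h0 ;; f = k0) (en : hn ;; g = kn)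
      (phi : cell P p k0 kn),
    vcomp (rfact e0 en phi) (cart p f g) ~= phi;
  rfact_unique : forall (X Y Z W : vcat) (p : loose X Y) (f : tight Z Y)
      (g : tight W X) (A0 An : vcat) (P : chainof vcat A0 An) (h0 : tight A0 Z)
      (hn : tight An W) (k0 : tight A0 Y) (kn : tight An X)
      (e0 : h0 ;; f = k0) (en : hn ;; g = kn)
      (phi : cell P p k0 kn) (psi : cell P (restr p f g) h0 hn),
    vcomp psi (cart p f g) ~= phi -> psi = rfact e0 en phi;

  U : forall A : vcat, loose A A;
  ucell : forall A : vcat, gcell cnil (U A);
  ufact : forall (A0 A An B0 Bn : vcat) (L : chainof vcat A0 A) (R : chainof vcat A An)
      (q : loose Bn B0) (f0 : tight A0 B0) (fn : tight An Bn),
    cell (L +++ R) q f0 fn -> cell (L +++ U A ::c R) q f0 fn;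
  ufactK : forall (A0 A An B0 Bn : vcat) (L : chainof vcat A0 A)
      (R : chainof vcat A An) (q : loose Bn B0) (f0 : tight A0 B0) (fn : tight An Bn)
      (phi : cell (L +++ R) q f0 fn),
    paste (row_app (id_row L) (rcons (ucell A) (id_row R))) (ufact phi) ~= phi;
  ufact_unique : forall (A0 A An B0 Bn : vcat) (L : chainof vcat A0 A)
      (R : chainof vcat A An) (q : loose Bn B0) (f0 : tight A0 B0) (fn : tight An Bn)
      (phi : cell (L +++ R) q f0 fn) (psi : cell (L +++ U A ::c R) q f0 fn),
    paste (row_app (id_row L) (rcons (ucell A) (id_row R))) psi ~= phi ->
    psi = ufact phi
}.

Arguments restr {_ X Y Z W} p f g.
Arguments cart {_ X Y Z W} p f g.
Arguments rfact {_ X Y Z W p f g A0 An P h0 hn k0 kn} e0 en phi.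
Arguments U {_} A.
Arguments ucell {_} A.
Arguments ufact {_ A0 A An B0 Bn} L R {q f0 fn} phi.

(** [hom f g] is [B(f,g) = B(1,1)(f,g)]. *)
Definition hom (X : virtual_equipment) (B Y Z : X) (f : tight Z B) (g : tight Y B) :
  loose Y Z := restr (U B) f g.

(** The identity 2-cell [f => f]. *)
Definition id2 (X : virtual_equipment) (A B : X) (f : tight A B) :
    gcell cnil (hom f f) :=
  rfact (eq_trans (tidl f) (eq_sym (tidr f))) (eq_trans (tidl f) (eq_sym (tidr f)))
        (paste (rnil f) (ucell B)).

Definition U_mult (X : virtual_equipment) (B : X) : gcell (U B ::c [U B]c) (U B) :=
  ufact cnil [U B]c (idcell (U B)).

(** The composition 2-cell [B(f,g), B(g,h) => B(f,h)]. *)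
Definition hom_comp (X : virtual_equipment) (B Y Z W : X)
    (f : tight Y B) (g : tight Z B) (h : tight W B) :
    gcell (hom f g ::c [hom g h]c) (hom f h) :=
  rfact (eq_trans (tidl f) (eq_sym (tidr f))) (eq_trans (tidl h) (eq_sym (tidr h)))
        (paste (row2 (cart (U B) f g) (cart (U B) g h)) (U_mult B)).

Definition U_map (X : virtual_equipment) (B C : X) (k : tight B C) :
    cell [U B]c (U C) (k ;; tid C) (k ;; tid C) :=
  ufact cnil cnil (paste (rnil k) (ucell C)).

Lemma hom_map_side (X : virtual_equipment) (B C Y : X)
    (f : tight Y B) (k : tight B C) :
  tid Y ;; (f ;; k) = f ;; (k ;; tid C).
Proof. now rewrite tidl, tidr. Qed.

(** The 2-cell [B(f,g) => C(kf,kg)] induced by [k]. *)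
Definition hom_map (X : virtual_equipment) (B C Y Z : X)
    (f : tight Y B) (g : tight Z B) (k : tight B C) :
    gcell [hom f g]c (hom (f ;; k) (g ;; k)) :=
  rfact (hom_map_side f k) (hom_map_side g k) (vcomp (cart (U B) f g) (U_map k)).

(** [(phi ; k)].  Its sides are [tid _ ;; tid _], as for any pasting of 2-cells with
    identity sides. *)
Definition whisker (X : virtual_equipment) (B C Y Z : X) (P : chainof X Y Z)
    (f : tight Y B) (g : tight Z B) (phi : gcell P (hom f g)) (k : tight B C) :
    cell (P +++ cnil) (hom (f ;; k) (g ;; k)) (tid Y ;; tid Y) (tid Z ;; tid Z) :=
  vcomp phi (hom_map f g k).

(** The 2-cell [B(g,h) => B(f,h)] induced by [sigma : f => g]. *)
Definition hom_precomp (X : virtual_equipment) (B Y Z : X) (f g : tight Y B)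
    (sigma : gcell cnil (hom f g)) (h : tight Z B) :
    cell [hom g h]c (hom f h) (tid Y ;; tid Y) (tid Z ;; tid Z) :=
  paste (row2 sigma (idcell (hom g h))) (hom_comp f g h).

Lemma restr_along_sidel (X : virtual_equipment) (B Y : X) (s : tight Y B) :
  tid Y ;; s = tid Y ;; tid Y ;; s.
Proof. now rewrite !tidl. Qed.

Lemma restr_along_sider (X : virtual_equipment) (B D Y : X)
    (x : tight Y D) (e : tight D B) :
  tid Y ;; (x ;; e) = x ;; tid D ;; e.
Proof. now rewrite tidl, tidr. Qed.

(** The restriction [phi(1,x) : E(j,ex) => E(t,ex)] of [phi : E(j,e) => E(t,e)]: the
    2-cell whose pasting with the cartesian 2-cell [E(t,ex) => E(1,1)] is the pasting of
    the canonical 2-cell [E(j,ex) => E(j,e)] (with sides [1] and [x]), [phi] and the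
    cartesian 2-cell [E(t,e) => E(1,1)]. *)
Definition restr_along (X : virtual_equipment) (A D E Y : X) (j t : tight A E)
    (e : tight D E) (phi : gcell [hom j e]c (hom t e)) (x : tight Y D) :
    gcell [hom j (x ;; e)]c (hom t (x ;; e)) :=
  rfact (restr_along_sidel t) (restr_along_sider x e)
    (vcomp
      (vcomp (rfact (tidl j) (eq_refl (x ;; e)) (cart (U E) j (x ;; e))
                : cell _ (hom j e) (tid A) x) phi)
      (cart (U E) t e)).

Record relative_monad (X : virtual_equipment) (A E : X) (j : tight A E) : Type := {
  rm_t : tight A E;
  rm_ext : gcell [hom j rm_t]c (hom rm_t rm_t);
  rm_unit : gcell cnil (hom j rm_t);
  rm_ext_unit :
    vcomp rm_ext (hom_precomp rm_unit rm_t) ~= idcell (hom j rm_t);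
  rm_unit_ext :
    vcomp rm_unit rm_ext ~= id2 rm_t;
  rm_ext_ext :
    paste (row2 rm_ext rm_ext) (hom_comp rm_t rm_t rm_t)
    ~= vcomp (paste (row2 (idcell (hom j rm_t)) rm_ext) (hom_comp j rm_t rm_t)) rm_ext
}.

Record algebra (X : virtual_equipment) (A E : X) (j : tight A E)
    (T : relative_monad j) (D : X) : Type := {
  alg_e : tight D E;
  alg_act : gcell [hom j alg_e]c (hom (rm_t T) alg_e);
  alg_unit :
    vcomp alg_act (hom_precomp (rm_unit T) alg_e) ~= idcell (hom j alg_e);
  alg_assoc :
    paste (row2 (rm_ext T) alg_act) (hom_comp (rm_t T) (rm_t T) alg_e)
    ~= vcomp (paste (row2 (idcell (hom j (rm_t T))) alg_act)
                    (hom_comp j (rm_t T) alg_e)) alg_act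
}.

Definition graded_morphism (X : virtual_equipment) (A E : X) (j : tight A E)
    (T : relative_monad j) (D D' : X) (P : chainof X D D')
    (a : algebra T D) (a' : algebra T D') (eps : gcell P (hom (alg_e a) (alg_e a'))) :
    Prop :=
  paste (row2 (alg_act a) eps) (hom_comp (rm_t T) (alg_e a) (alg_e a'))
  ~= vcomp (paste (row2 (idcell (hom j (alg_e a))) eps)
                  (hom_comp j (alg_e a) (alg_e a'))) (alg_act a').

(** [ao_lift] is the assignment [e |-> <e>]. *)
Record algebra_object (X : virtual_equipment) (A E : X) (j : tight A E)
    (T : relative_monad j) : Type := {
  Alg : X;
  ao_alg : algebra T Alg;
  ao_lift : forall D : X, algebra T D -> tight D Alg;
  ao_lift_e : forall (D : X) (a : algebra T D), ao_lift a ;; alg_e ao_alg = alg_e a;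
  ao_lift_act : forall (D : X) (a : algebra T D),
    restr_along (alg_act ao_alg) (ao_lift a) ~= alg_act a;
  ao_lift_unique : forall (D : X) (a : algebra T D) (h : tight D Alg),
    h ;; alg_e ao_alg = alg_e a ->
    restr_along (alg_act ao_alg) h ~= alg_act a ->
    h = ao_lift a;
  ao_lift_cell : forall (D D' : X) (P : chainof X D D') (a : algebra T D)
      (a' : algebra T D') (eps : gcell P (hom (alg_e a) (alg_e a'))),
    graded_morphism eps ->
    exists! eps' : gcell P (hom (ao_lift a) (ao_lift a')),
      whisker eps' (alg_e ao_alg) ~= eps
}.

Definition ao_u (X : virtual_equipment) (A E : X) (j : tight A E)
    (T : relative_monad j) (M : algebra_object T) : tight (Alg M) E :=
  alg_e (ao_alg M).

Record cone (X : virtual_equipment) (Y Z W : X) (p : loose Y Z) (f : tight Y W) :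
    Type := {
  cone_pt : tight Z W;
  cone_cell : gcell [p]c (hom cone_pt f)
}.

Definition is_limit (X : virtual_equipment) (Y Z W : X) (p : loose Y Z)
    (f : tight Y W) (c : cone p f) : Prop :=
  forall (Q : chainof X W Z) (chi : gcell (Q +++ [p]c) (hom (tid W) f)),
  exists! phi : gcell Q (hom (tid W) (cone_pt c)),
    paste (row2 phi (cone_cell c)) (hom_comp (tid W) (cone_pt c) f) ~= chi.

Definition strictly_created (X : virtual_equipment) (Y Z W V : X) (p : loose Y Z)
    (f : tight Y W) (g : tight W V) (c : cone p (f ;; g)) : Prop :=
  exists c' : cone p f,
    unique (fun d : cone p f => cone_pt d ;; g = cone_pt c
                                /\ whisker (cone_cell d) g ~= cone_cell c) c'
    /\ is_limit c'.

Definition strictly_creates_limits (X : virtual_equipment) (W V : X)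
    (g : tight W V) : Prop :=
  forall (Y Z : X) (p : loose Y Z) (f : tight Y W) (c : cone p (f ;; g)),
    is_limit c -> strictly_created c.

(* Main.v *)
(** Write [u : Alg(T) -> E] for the algebra object.  A 2-cell [P => B(f,g)] is the same
    as a 2-cell from [P] to [B(1,1)] with sides [f] and [g].  In this form composition
    is an associative unital product [mul], and an action [E(j,e) => E(t,e)] becomes a
    natural operation [op] taking [Phi] with sides [(j, x;e)] to one with sides
    [(t, x;e)]; a graded morphism is an [eps] with [op Phi . eps = op (Phi . eps)].
    By naturality every 2-cell of the form [(theta;u)] is a graded morphism.

    Let [(x, mu)] be the limit of [(f;u)].  Sliding a tight-cell [s] into the chain as
    the loose-cell [E(1,s)] extends the universal property of [mu] to 2-cells with
    arbitrary left side.  Hence there is a unique action on [x] with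
    [op Phi . mu = op (Phi . mu)]; cancelling [mu] gives the algebra laws and makes [mu]
    graded, so [x] and [mu] lift uniquely to [w] and [mu'].  For a cone
    [chi : Q, p => Alg(T)(1,f)], the factorization of [(chi;u)] through [mu] is graded,
    again by cancelling [mu], hence lifts to a factorization of [chi] through [mu']. *)

Require Import Defs.
From Stdlib Require Import Eqdep.

Set Implicit Arguments.
Unset Strict Implicit.
Unset Printing Implicit Defensive.

(** * Concatenation of chains *)

Section Chains.
Context (ob : Type) (loose : ob -> ob -> Type).

Lemma capp_nil A B (P : chain loose A B) : capp P cnil = P.
Proof. induction P as [|? ? ? p P IH]; simpl; [|rewrite IH]; reflexivity. Qed.

Lemma cappA A B C D (P : chain loose A B) (Q : chain loose B C) (R : chain loose C D) :
  capp (capp P Q) R = capp P (capp Q R).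
Proof. induction P as [|? ? ? p P IH]; simpl; [|rewrite IH]; reflexivity. Qed.

End Chains.

(** * Heterogeneous equality of 2-cells and of rows *)

Section CellEquality.
Context (X : vdc_data).

Section Boundary.
Context (A0 An B0 Bn : X).

(** The boundary equations hidden in the indices of [ceq] are made explicit, so that they can be
    eliminated one at a time. *)
Lemma ceq_transport (P P' : chainof X A0 An) (q q' : loose Bn B0) (f0 f0' : tight A0 B0)
    (fn fn' : tight An Bn) (phi : cell P q f0 fn) (psi : cell P' q' f0' fn') :
  phi ~= psi ->
  exists (eP : P = P') (eq : q = q') (e0 : f0 = f0') (en : fn = fn'),
    psi = eq_rect _ (fun R => cell R q' f0' fn')
            (eq_rect _ (fun r => cell P r f0' fn')
              (eq_rect _ (fun g => cell P q g fn')
                 (eq_rect _ (fun g => cell P q f0 g) phi _ en) _ e0) _ eq) _ eP.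
Proof. intros []; now exists eq_refl, eq_refl, eq_refl, eq_refl. Qed.

(** The transports are along loops, which the axiom of uniqueness of identity proofs from [Eqdep]
    trivializes. *)
Lemma ceq_eq (P : chainof X A0 An) (q : loose Bn B0) (f0 : tight A0 B0)
    (fn : tight An Bn) (phi psi : cell P q f0 fn) : phi ~= psi -> phi = psi.
Proof.
intros H; destruct (ceq_transport H) as (eP & eq & e0 & en & ->).
now rewrite (UIP_refl _ _ eP), (UIP_refl _ _ eq), (UIP_refl _ _ e0), (UIP_refl _ _ en).
Qed.

Lemma ceq_of_eq (P : chainof X A0 An) (q : loose Bn B0) (f0 : tight A0 B0)
    (fn : tight An Bn) (phi psi : cell P q f0 fn) : phi = psi -> phi ~= psi.
Proof. intros ->; apply ceq_refl. Qed.

Lemma ceq_sym (P P' : chainof X A0 An) (q q' : loose Bn B0) (f0 f0' : tight A0 B0)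
    (fn fn' : tight An Bn) (phi : cell P q f0 fn) (psi : cell P' q' f0' fn') :
  phi ~= psi -> psi ~= phi.
Proof. intros []; apply ceq_refl. Qed.

Lemma ceq_trans (P P' P'' : chainof X A0 An) (q q' q'' : loose Bn B0)
    (f0 f0' f0'' : tight A0 B0) (fn fn' fn'' : tight An Bn) (phi : cell P q f0 fn)
    (psi : cell P' q' f0' fn') (chi : cell P'' q'' f0'' fn'') :
  phi ~= psi -> psi ~= chi -> phi ~= chi.
Proof. intros [] H; exact H. Qed.

Definition ccast (P P' : chainof X A0 An) (q : loose Bn B0) (f0 f0' : tight A0 B0)
    (fn fn' : tight An Bn) (eP : P = P') (e0 : f0 = f0') (en : fn = fn')
    (phi : cell P q f0 fn) : cell P' q f0' fn' :=
  match eP, e0, en with eq_refl, eq_refl, eq_refl => phi end.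

Lemma ccast_ceq (P P' : chainof X A0 An) (q : loose Bn B0) (f0 f0' : tight A0 B0)
    (fn fn' : tight An Bn) (eP : P = P') (e0 : f0 = f0') (en : fn = fn')
    (phi : cell P q f0 fn) : ccast eP e0 en phi ~= phi.
Proof. destruct eP, e0, en; apply ceq_refl. Qed.

End Boundary.

Inductive req (A0 An B0 Bn : X) (Q : chainof X B0 Bn) (f0 : tight A0 B0)
    (fn : tight An Bn) (Phi : row Q f0 fn) :
    forall (Q' : chainof X B0 Bn) (f0' : tight A0 B0) (fn' : tight An Bn),
      row Q' f0' fn' -> Prop :=
| req_refl : req Phi Phi.

Lemma req_sym (A0 An B0 Bn : X) (Q Q' : chainof X B0 Bn)
    (f0 f0' : tight A0 B0) (fn fn' : tight An Bn)
    (Phi : row Q f0 fn) (Phi' : row Q' f0' fn') :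
  req Phi Phi' -> req Phi' Phi.
Proof. intros []; apply req_refl. Qed.

Lemma req_transport (A0 An B0 Bn : X) (Q Q' : chainof X B0 Bn)
    (f0 f0' : tight A0 B0) (fn fn' : tight An Bn)
    (Phi : row Q f0 fn) (Phi' : row Q' f0' fn') :
  req Phi Phi' ->
  exists (eQ : Q = Q') (e0 : f0 = f0') (en : fn = fn'),
    Phi' = eq_rect _ (fun R => row R f0' fn')
            (eq_rect _ (fun g => row Q g fn')
               (eq_rect _ (fun g => row Q f0 g) Phi _ en) _ e0) _ eQ.
Proof. intros []; now exists eq_refl, eq_refl, eq_refl. Qed.

Lemma req_eq (A0 An B0 Bn : X) (Q : chainof X B0 Bn)
    (f0 : tight A0 B0) (fn : tight An Bn) (Phi Phi' : row Q f0 fn) :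
  req Phi Phi' -> Phi = Phi'.
Proof.
intros H; destruct (req_transport H) as (eQ & e0 & en & ->).
now rewrite (UIP_refl _ _ eQ), (UIP_refl _ _ e0), (UIP_refl _ _ en).
Qed.

End CellEquality.

(** Meant for boundaries that are variables: they are substituted first, after which the
    heterogeneous equality becomes an ordinary one. *)
Ltac ceq_subst H :=
  let H' := fresh in
  let e := fresh in
  first [ pose proof (ceq_transport H) as H'; destruct H' as (? & ? & ? & ? & e)
        | pose proof (req_transport H) as H'; destruct H' as (? & ? & ? & e) ];
  clear e; subst;
  first [ apply ceq_eq in H | apply req_eq in H ]; subst.

(** * Congruence and associativity laws for pasting *)

Section RowEquality.
Context (X : vdc).

Lemma rcons_cong (A0 A1 An B0 B1 Bn : X) (P P' : chainof X A0 A1) (q q' : loose B1 B0)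
    (Q Q' : chainof X B1 Bn) (f0 f0' : tight A0 B0) (f1 f1' : tight A1 B1)
    (fn fn' : tight An Bn) (phi : cell P q f0 f1) (phi' : cell P' q' f0' f1')
    (Phi : row Q f1 fn) (Phi' : row Q' f1' fn') :
  phi ~= phi' -> req Phi Phi' -> req (rcons phi Phi) (rcons phi' Phi').
Proof. intros H K; ceq_subst H; ceq_subst K; apply req_refl. Qed.

Lemma row_app_cong (A0 A1 An B0 B1 Bn : X) (Q Q' : chainof X B0 B1)
    (R R' : chainof X B1 Bn) (f0 f0' : tight A0 B0) (f1 f1' : tight A1 B1)
    (fn fn' : tight An Bn) (Phi : row Q f0 f1) (Phi' : row Q' f0' f1')
    (Psi : row R f1 fn) (Psi' : row R' f1' fn') :
  req Phi Phi' -> req Psi Psi' -> req (row_app Phi Psi) (row_app Phi' Psi').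
Proof. intros H K; ceq_subst H; ceq_subst K; apply req_refl. Qed.

Lemma row_app_nil (A0 An B0 Bn : X) (Q : chainof X B0 Bn) (f0 : tight A0 B0)
    (fn : tight An Bn) (Phi : row Q f0 fn) : req (row_app Phi (rnil fn)) Phi.
Proof.
induction Phi; simpl; [apply req_refl|].
apply rcons_cong; [apply ceq_refl|assumption].
Qed.

Lemma row_top_app (A0 A1 An B0 B1 Bn : X) (Q : chainof X B0 B1)
    (R : chainof X B1 Bn) (f0 : tight A0 B0) (f1 : tight A1 B1)
    (fn : tight An Bn) (Phi : row Q f0 f1) (Psi : row R f1 fn) :
  row_top (row_app Phi Psi) = row_top Phi +++ row_top Psi.
Proof.
revert R fn Psi; induction Phi; intros; simpl; [reflexivity|].
now rewrite IHPhi, cappA.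
Qed.

Lemma row_top_id (A0 An : X) (P : chainof X A0 An) : row_top (id_row P) = P.
Proof.
unfold id_row; induction P as [|? ? ? p P IH]; simpl; [|rewrite IH]; reflexivity.
Qed.

Lemma id_row_app (A0 A1 An : X) (P : chainof X A0 A1) (Q : chainof X A1 An) :
  id_row (P +++ Q) = row_app (id_row P) (id_row Q).
Proof.
unfold id_row; induction P as [|? ? ? p P IH]; simpl; [|rewrite IH]; reflexivity.
Qed.

Lemma paste_cong (A0 An B0 Bn C0 Cn : X) (Q Q' : chainof X B0 Bn) (r r' : loose Cn C0)
    (f0 f0' : tight A0 B0) (fn fn' : tight An Bn) (g0 g0' : tight B0 C0)
    (gn gn' : tight Bn Cn) (Phi : row Q f0 fn) (Phi' : row Q' f0' fn')
    (chi : cell Q r g0 gn) (chi' : cell Q' r' g0' gn') :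
  req Phi Phi' -> chi ~= chi' -> paste Phi chi ~= paste Phi' chi'.
Proof. intros H K; ceq_subst H; ceq_subst K; apply ceq_refl. Qed.

Lemma vcomp_cong (A0 An B0 Bn C0 Cn : X) (P P' : chainof X A0 An) (q q' : loose Bn B0)
    (r r' : loose Cn C0)
    (f0 f0' : tight A0 B0) (fn fn' : tight An Bn) (g0 g0' : tight B0 C0)
    (gn gn' : tight Bn Cn) (phi : cell P q f0 fn) (phi' : cell P' q' f0' fn')
    (chi : cell [q]c r g0 gn) (chi' : cell [q']c r' g0' gn') :
  phi ~= phi' -> chi ~= chi' -> vcomp phi chi ~= vcomp phi' chi'.
Proof. intros H K; ceq_subst H; ceq_subst K; apply ceq_refl. Qed.

(** Associativity for a tower whose lower row is a single 2-cell. The top of [vcomp phi chi] is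
    [Q +++ cnil], which is not convertible to [Q], so [psi] stands in for this composite. *)
Lemma paste_vcomp (A0 An B0 Bn C0 Cn D0 Dn : X) (Q : chainof X B0 Bn) (r : loose Cn C0)
    (s : loose Dn D0) (f0 : tight A0 B0) (fn : tight An Bn) (g0 : tight B0 C0)
    (gn : tight Bn Cn) (h0 : tight C0 D0) (hn : tight Cn Dn) (k0 : tight B0 D0)
    (kn : tight Bn Dn) (Phi : row Q f0 fn) (phi : cell Q r g0 gn)
    (chi : cell [r]c s h0 hn) (psi : cell Q s k0 kn) :
  psi ~= vcomp phi chi -> paste Phi psi ~= vcomp (paste Phi phi) chi.
Proof.
intros H.
refine (ceq_trans _ (pasteA (tcons Phi phi (tnil fn gn)) chi)).
apply paste_cong; [apply req_sym, row_app_nil | exact H].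
Qed.

Lemma vcompA (A0 An B0 Bn C0 Cn D0 Dn : X) (P : chainof X A0 An) (q : loose Bn B0)
    (r : loose Cn C0) (s : loose Dn D0) (f0 : tight A0 B0) (fn : tight An Bn)
    (g0 : tight B0 C0) (gn : tight Bn Cn) (h0 : tight C0 D0) (hn : tight Cn Dn)
    (phi : cell P q f0 fn) (psi : cell [q]c r g0 gn) (chi : cell [r]c s h0 hn) :
  vcomp phi (vcomp psi chi) ~= vcomp (vcomp phi psi) chi.
Proof. exact (paste_vcomp (row1 phi) (ceq_refl _)). Qed.

End RowEquality.

(** * The product of 2-cells into a loose-identity *)

Section Equipment.
Context (X : virtual_equipment).

Definition hcart (B Y Z : X) (f : tight Z B) (g : tight Y B) :
  cell [hom f g]c (U B) f g := cart (U B) f g.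

Lemma hcart_cong (B Y Z : X) (f f' : tight Z B) (g g' : tight Y B) :
  f = f' -> g = g' -> hcart f g ~= hcart f' g'.
Proof. intros [] []; apply ceq_refl. Qed.

(** The uniqueness half of the universal property of a restriction. Equality of composites such as
    [a ;; f] would not equate the sides, hence the four side equations; the equality of the tops is
    read off from the equation of 2-cells. *)
Lemma hcart_inj (B Y Z A0 An : X) (P P' : chainof X A0 An) (f f' : tight Z B)
    (g g' : tight Y B) (a a' : tight A0 Z) (b b' : tight An Y)
    (phi : cell P (hom f g) a b) (phi' : cell P' (hom f' g') a' b') :
  f = f' -> g = g' -> a = a' -> b = b' ->
  vcomp phi (hcart f g) ~= vcomp phi' (hcart f' g') -> phi ~= phi'.
Proof.
intros ef eg ea eb H.
destruct (ceq_transport H) as (eP & _); rewrite !capp_nil in eP.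
subst; apply ceq_of_eq.
pose (e0 := eq_refl (a' ;; f')); pose (en := eq_refl (b' ;; g')).
assert (K : vcomp phi' (hcart f' g')
            ~= ccast (capp_nil P') e0 en (vcomp phi' (hcart f' g')))
  by apply ceq_sym, ccast_ceq.
exact (eq_trans (rfact_unique e0 en (ceq_trans H K)) (eq_sym (rfact_unique e0 en K))).
Qed.

Definition factor (B Y Z A0 An : X) (P : chainof X A0 An) (f : tight Z B)
    (g : tight Y B) (a : tight A0 Z) (b : tight An Y) (k : tight A0 B) (l : tight An B)
    (ek : a ;; f = k) (el : b ;; g = l) (Phi : cell P (U B) k l) :
  cell P (hom f g) a b := rfact ek el Phi.

Lemma factorK (B Y Z A0 An : X) (P : chainof X A0 An) (f : tight Z B)
    (g : tight Y B) (a : tight A0 Z) (b : tight An Y) (k : tight A0 B) (l : tight An B)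
    (ek : a ;; f = k) (el : b ;; g = l) (Phi : cell P (U B) k l) :
  vcomp (factor ek el Phi) (hcart f g) ~= Phi.
Proof. apply rfactK. Qed.

Definition one (B Y : X) (f : tight Y B) : cell cnil (U B) f f :=
  ccast eq_refl (tidr f) (tidr f) (paste (rnil f) (ucell B)).

Lemma mul_top (A0 A1 A2 : X) (P : chainof X A0 A1) (Q : chainof X A1 A2) :
  P +++ Q +++ cnil = P +++ Q.
Proof. now rewrite capp_nil. Qed.

(** Horizontal composition along [U_mult B]; the cast removes the [cnil] and the [tid] that pasting
    leaves in the boundary. *)
Definition mul (B A0 A1 A2 : X) (P : chainof X A0 A1) (Q : chainof X A1 A2)
    (f : tight A0 B) (g : tight A1 B) (h : tight A2 B)
    (Phi : cell P (U B) f g) (Psi : cell Q (U B) g h) : cell (P +++ Q) (U B) f h :=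
  ccast (mul_top P Q) (tidr f) (tidr h) (paste (row2 Phi Psi) (U_mult B)).

Lemma mulE (B A0 A1 A2 : X) (P : chainof X A0 A1) (Q : chainof X A1 A2)
    (f : tight A0 B) (g : tight A1 B) (h : tight A2 B)
    (Phi : cell P (U B) f g) (Psi : cell Q (U B) g h) :
  mul Phi Psi ~= paste (row2 Phi Psi) (U_mult B).
Proof. apply ccast_ceq. Qed.

Lemma row2_cong (A0 A1 A2 B0 B1 B2 : X) (P P' : chainof X A0 A1)
    (Q Q' : chainof X A1 A2) (p p' : loose B1 B0) (q q' : loose B2 B1)
    (f f' : tight A0 B0) (g g' : tight A1 B1) (h h' : tight A2 B2)
    (Phi : cell P p f g) (Phi' : cell P' p' f' g')
    (Psi : cell Q q g h) (Psi' : cell Q' q' g' h') :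
  Phi ~= Phi' -> Psi ~= Psi' -> req (row2 Phi Psi) (row2 Phi' Psi').
Proof. intros H K; ceq_subst H; ceq_subst K; apply req_refl. Qed.

Lemma mul_cong (B A0 A1 A2 : X) (P P' : chainof X A0 A1) (Q Q' : chainof X A1 A2)
    (f f' : tight A0 B) (g g' : tight A1 B) (h h' : tight A2 B)
    (Phi : cell P (U B) f g) (Phi' : cell P' (U B) f' g')
    (Psi : cell Q (U B) g h) (Psi' : cell Q' (U B) g' h') :
  Phi ~= Phi' -> Psi ~= Psi' -> mul Phi Psi ~= mul Phi' Psi'.
Proof. intros H K; ceq_subst H; ceq_subst K; apply ceq_refl. Qed.

Lemma paste_nil_tid (A B0 Bn : X) (q : loose Bn B0) (g0 : tight A B0)
  (gn : tight A Bn) (phi : cell cnil q g0 gn) : paste (rnil (tid A)) phi ~= phi.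
Proof. apply (paste_idl (P := cnil)). Qed.

Lemma U_mult_ul (B : X) :
  paste (row2 (ucell B) (idcell (U B))) (U_mult B) ~= idcell (U B).
Proof. apply (ufactK (L := cnil) (R := [U B]c)). Qed.

(** Associativity of pasting reduces this to the left unit law of [U_mult]. The factors are left
    uncast so that the equation also serves for [U_mult_ur] and [U_multA]. *)
Lemma one_mul_raw (B A0 A1 : X) (P : chainof X A0 A1) (f : tight A0 B) (g : tight A1 B)
    (Phi : cell P (U B) f g) :
  paste (row2 (paste (rnil f) (ucell B)) (paste (row1 Phi) (idcell (U B)))) (U_mult B)
  ~= Phi.
Proof.
refine (ceq_trans (ceq_sym (pasteA
  (tcons (rnil f) (ucell B) (tcons (row1 Phi) (idcell (U B)) (tnil g (tid B))))
  (U_mult B))) _).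
refine (ceq_trans _ (paste_idr Phi)).
exact (paste_cong (req_refl _) (U_mult_ul B)).
Qed.

Lemma mul_1l (B A0 A1 : X) (P : chainof X A0 A1) (f : tight A0 B) (g : tight A1 B)
    (Phi : cell P (U B) f g) : mul (one f) Phi ~= Phi.
Proof.
refine (ceq_trans (mulE _ _) (ceq_trans _ (one_mul_raw Phi))).
refine (paste_cong (row2_cong _ _) (ceq_refl _)).
- apply ccast_ceq.
- apply ceq_sym, paste_idr.
Qed.

Lemma ucell_inj (A0 A An B0 Bn : X) (L : chainof X A0 A)
    (R : chainof X A An) (q : loose Bn B0) (f0 f0' : tight A0 B0) (fn fn' : tight An Bn)
    (phi : cell (L +++ U A ::c R) q f0 fn) (psi : cell (L +++ U A ::c R) q f0' fn') :
  paste (row_app (id_row L) (rcons (ucell A) (id_row R))) phi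
  ~= paste (row_app (id_row L) (rcons (ucell A) (id_row R))) psi ->
  f0 = f0' -> fn = fn' -> phi ~= psi.
Proof.
intros H e0 en; subst; apply ceq_of_eq.
pose (chi := paste (row_app (id_row L) (rcons (ucell A) (id_row R))) psi).
assert (eP : row_top (row_app (id_row L) (rcons (ucell A) (id_row R))) = L +++ R)
  by now rewrite row_top_app; simpl; rewrite !row_top_id.
pose (chi' := ccast eP (tidl _) (tidl _) chi).
assert (K : chi' ~= chi) by apply ccast_ceq.
rewrite (ufact_unique (ceq_trans H (ceq_sym K))).
symmetry; apply ufact_unique, ceq_sym, K.
Qed.

(** After precomposition with [ucell B] both factors become [ucell B], so the left unit law
    applies. *)
Lemma U_mult_ur (B : X) :
  paste (row2 (idcell (U B)) (ucell B)) (U_mult B) ~= idcell (U B).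
Proof.
refine (ucell_inj (L := cnil) (R := cnil) _ (tidl _) (tidl _)).
refine (ceq_trans (pasteA (tcons (row1 (ucell B)) (idcell (U B))
   (tcons (rnil (tid B)) (ucell B) (tnil (tid B) (tid B)))) (U_mult B)) _).
refine (ceq_trans _ (ceq_trans (one_mul_raw (ucell B)) (ceq_sym (paste_idr _)))).
refine (paste_cong (row2_cong _ _) (ceq_refl _)).
- exact (ceq_trans (paste_idr _) (ceq_sym (paste_nil_tid _))).
- exact (ceq_trans (paste_nil_tid _) (ceq_sym (paste_idr _))).
Qed.

Lemma mul_1r (B A0 A1 : X) (P : chainof X A0 A1) (f : tight A0 B) (g : tight A1 B)
    (Phi : cell P (U B) f g) : mul Phi (one g) ~= Phi.
Proof.
refine (ceq_trans (mulE _ _) (ceq_trans _ (paste_idr Phi))).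
refine (ceq_trans (ceq_trans _ (ceq_sym (pasteA
  (tcons (row1 Phi) (idcell (U B)) (tcons (rnil g) (ucell B) (tnil g (tid B))))
  (U_mult B)))) (paste_cong (req_refl _) (U_mult_ur B))).
refine (paste_cong (row2_cong _ _) (ceq_refl _)).
- apply ceq_sym, paste_idr.
- apply ccast_ceq.
Qed.

(** Precomposing the first entry with [ucell B] turns both sides into [U_mult B], by the left unit
    law. *)
Lemma U_multA (B : X) :
  paste (row2 (U_mult B) (idcell (U B))) (U_mult B)
  ~= paste (row2 (idcell (U B)) (U_mult B)) (U_mult B).
Proof.
refine (ucell_inj (L := cnil) (R := U B ::c [U B]c) _ eq_refl eq_refl).
refine (ceq_trans _ (ceq_trans (paste_idl (U_mult B)) _)).
- refine (ceq_trans (pasteA (tcons (row2 (ucell B) (idcell (U B))) (U_mult B)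
    (tcons (row1 (idcell (U B))) (idcell (U B)) (tnil (tid B) (tid B)))) (U_mult B)) _).
  refine (paste_cong (row2_cong (U_mult_ul B) (paste_idr _)) (ceq_refl _)).
- refine (ceq_trans _ (ceq_sym (pasteA (tcons (row1 (ucell B)) (idcell (U B))
    (tcons (row2 (idcell (U B)) (idcell (U B))) (U_mult B) (tnil (tid B) (tid B))))
    (U_mult B)))).
  refine (ceq_trans (ceq_sym (one_mul_raw _)) _).
  refine (paste_cong (row2_cong _ _) (ceq_refl _)).
  + exact (ceq_trans (paste_nil_tid _) (ceq_sym (paste_idr _))).
  + exact (ceq_trans (paste_idr _) (ceq_sym (paste_idl _))).
Qed.

Lemma mulA (B A0 A1 A2 A3 : X) (P : chainof X A0 A1) (Q : chainof X A1 A2)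
    (R : chainof X A2 A3)
    (f : tight A0 B) (g : tight A1 B) (h : tight A2 B) (k : tight A3 B)
    (Phi : cell P (U B) f g) (Psi : cell Q (U B) g h) (Theta : cell R (U B) h k) :
  mul (mul Phi Psi) Theta ~= mul Phi (mul Psi Theta).
Proof.
refine (ceq_trans (ceq_trans (mulE _ _) _) (ceq_trans (paste_cong
   (req_refl (rcons Phi (row2 Psi Theta))) (U_multA B))
   (ceq_trans _ (ceq_sym (mulE _ _))))).
- refine (ceq_trans _ (ceq_sym (pasteA (tcons (row2 Phi Psi) (U_mult B)
    (tcons (row1 Theta) (idcell (U B)) (tnil k (tid B)))) (U_mult B)))).
  exact (paste_cong (row2_cong (mulE _ _) (ceq_sym (paste_idr _))) (ceq_refl _)).
- refine (ceq_trans (pasteA (tcons (row1 Phi) (idcell (U B))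
    (tcons (row2 Psi Theta) (U_mult B) (tnil k (tid B)))) (U_mult B)) _).
  exact (paste_cong (row2_cong (paste_idr _) (ceq_sym (mulE _ _))) (ceq_refl _)).
Qed.

(** Interchange: associativity of pasting for a tower with two 2-cells in its lower row, over
    [U_mult B]. *)
Lemma paste_mul (B A0 A1 A2 B0 B1 B2 : X) (P : chainof X B0 B1) (Q : chainof X B1 B2)
    (a : tight A0 B0) (b : tight A1 B1) (c : tight A2 B2)
    (f : tight B0 B) (g : tight B1 B) (h : tight B2 B)
    (R : row P a b) (S : row Q b c) (Phi : cell P (U B) f g) (Psi : cell Q (U B) g h) :
  paste (row_app R S) (mul Phi Psi) ~= mul (paste R Phi) (paste S Psi).
Proof.
refine (ceq_trans _ (ceq_trans (pasteA (tcons R Phi (tcons S Psi (tnil c h)))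
  (U_mult B)) (ceq_sym (mulE _ _)))).
refine (paste_cong (row_app_cong (req_refl _) (req_sym (row_app_nil _))) (mulE _ _)).
Qed.

End Equipment.

(** * Transposing 2-cells into [hom f g] to 2-cells into a loose-identity *)

Section Transpose.
Context (X : virtual_equipment).

Lemma vcomp_id (A0 An B0 Bn : X) (p : loose An A0) (q : loose Bn B0)
    (f0 : tight A0 B0) (fn : tight An Bn) (phi : cell [p]c q f0 fn) :
  vcomp (idcell p) phi ~= phi.
Proof. exact (paste_idl phi). Qed.

Definition tr (B Y Z : X) (P : chainof X Y Z) (f : tight Y B) (g : tight Z B)
    (phi : gcell P (hom f g)) : cell P (U B) f g :=
  ccast (capp_nil P) (tidl f) (tidl g) (vcomp phi (hcart f g)).

Lemma trE (B Y Z : X) (P : chainof X Y Z) (f : tight Y B) (g : tight Z B)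
    (phi : gcell P (hom f g)) : tr phi ~= vcomp phi (hcart f g).
Proof. apply ccast_ceq. Qed.

Definition untr (B Y Z : X) (P : chainof X Y Z) (f : tight Y B) (g : tight Z B)
    (Phi : cell P (U B) f g) : gcell P (hom f g) := factor (tidl f) (tidl g) Phi.

Lemma untrK (B Y Z : X) (P : chainof X Y Z) (f : tight Y B) (g : tight Z B)
    (Phi : cell P (U B) f g) : tr (untr Phi) = Phi.
Proof. apply ceq_eq, (ceq_trans (trE _)), factorK. Qed.

Lemma tr_inj (B Y Z : X) (P : chainof X Y Z) (f : tight Y B) (g : tight Z B)
    (phi psi : gcell P (hom f g)) : tr phi = tr psi -> phi = psi.
Proof.
intros H; apply ceq_eq, hcart_inj; try reflexivity.
apply (ceq_trans (ceq_sym (trE _))); rewrite H; apply trE.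
Qed.

Lemma trK (B Y Z : X) (P : chainof X Y Z) (f : tight Y B) (g : tight Z B)
    (phi : gcell P (hom f g)) : untr (tr phi) = phi.
Proof. apply tr_inj, untrK. Qed.

(** [hom_comp] is the factorization of the product of two cartesian 2-cells, so interchange gives
    the general case. *)
Lemma hom_compE (B A0 A1 A2 C0 C1 C2 : X) (P : chainof X A0 A1) (Q : chainof X A1 A2)
    (f : tight C0 B) (g : tight C1 B) (h : tight C2 B) (a : tight A0 C0)
    (b : tight A1 C1) (c : tight A2 C2)
    (phi : cell P (hom f g) a b) (psi : cell Q (hom g h) b c) :
  vcomp (paste (row2 phi psi) (hom_comp f g h)) (hcart f h)
  ~= mul (vcomp phi (hcart f g)) (vcomp psi (hcart g h)).
Proof.
refine (ceq_trans _ (paste_mul (row1 phi) (row1 psi) (hcart f g) (hcart g h))).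
apply ceq_sym, paste_vcomp.
exact (ceq_trans (mulE (hcart f g) (hcart g h)) (ceq_sym (rfactK _ _ _))).
Qed.

Lemma tr_hom_comp (B Y Z W : X) (P : chainof X Y Z) (Q : chainof X Z W) (f : tight Y B)
    (g : tight Z B) (h : tight W B) (phi : gcell P (hom f g)) (psi : gcell Q (hom g h)) :
  vcomp (paste (row2 phi psi) (hom_comp f g h)) (hcart f h) ~= mul (tr phi) (tr psi).
Proof.
refine (ceq_trans (hom_compE _ _) (mul_cong _ _)); apply ceq_sym, trE.
Qed.

Lemma post_side (B C Y : X) (f : tight Y B) (k : tight B C) :
  f ;; (k ;; tid C) = f ;; k.
Proof. now rewrite tidr. Qed.

Definition post (B C Y Z : X) (k : tight B C) (P : chainof X Y Z) (f : tight Y B)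
    (g : tight Z B) (Phi : cell P (U B) f g) : cell P (U C) (f ;; k) (g ;; k) :=
  ccast (capp_nil P) (post_side f k) (post_side g k) (vcomp Phi (U_map k)).

Lemma postE (B C Y Z : X) (k : tight B C) (P : chainof X Y Z) (f : tight Y B)
    (g : tight Z B) (Phi : cell P (U B) f g) : post k Phi ~= vcomp Phi (U_map k).
Proof. apply ccast_ceq. Qed.

Lemma hom_mapE (B C Y Z : X) (f : tight Y B) (g : tight Z B) (k : tight B C) :
  vcomp (hom_map f g k) (hcart (f ;; k) (g ;; k)) ~= vcomp (hcart f g) (U_map k).
Proof. exact (rfactK _ _ _). Qed.

Lemma whiskerE (B C Y Z : X) (P : chainof X Y Z) (f : tight Y B) (g : tight Z B)
    (phi : gcell P (hom f g)) (k : tight B C) :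
  vcomp (whisker phi k) (hcart (f ;; k) (g ;; k)) ~= post k (tr phi).
Proof.
refine (ceq_trans (ceq_sym (vcompA _ _ _)) _).
refine (ceq_trans (paste_cong (req_refl (row1 phi)) (hom_mapE f g k)) _).
refine (ceq_trans (vcompA _ _ _) (ceq_sym (ceq_trans (postE _ _) _))).
exact (vcomp_cong (trE _) (ceq_refl _)).
Qed.

(** The sides of [psi] are composites with [k] only propositionally; this serves to compare cones
    whose apexes are not yet known to agree. *)
Lemma whisker_eq (B C Y Z : X) (P : chainof X Y Z) (f : tight Y B) (g : tight Z B)
    (f' : tight Y C) (g' : tight Z C) (phi : gcell P (hom f g)) (k : tight B C)
    (psi : gcell P (hom f' g')) :
  f ;; k = f' -> g ;; k = g' -> whisker phi k ~= psi <-> post k (tr phi) ~= tr psi.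
Proof.
intros <- <-; split; intros H.
- refine (ceq_trans (ceq_sym (whiskerE _ _)) (ceq_trans _ (ceq_sym (trE _)))).
  exact (vcomp_cong H (ceq_refl _)).
- apply hcart_inj; try reflexivity; try apply tidl.
  exact (ceq_trans (whiskerE _ _) (ceq_trans H (trE _))).
Qed.

Definition U_map1 (B C : X) (k : tight B C) : cell [U B]c (U C) k k :=
  ccast eq_refl (tidr k) (tidr k) (U_map k).

Lemma U_map1E (B C : X) (k : tight B C) : U_map1 k ~= U_map k.
Proof. apply ccast_ceq. Qed.

Lemma post_U_map1 (B C Y Z : X) (k : tight B C) (P : chainof X Y Z) (f : tight Y B)
    (g : tight Z B) (Phi : cell P (U B) f g) :
  post k Phi ~= paste (row1 Phi) (U_map1 k).
Proof.
exact (ceq_trans (postE _ _) (paste_cong (req_refl (row1 Phi)) (ceq_sym (U_map1E k)))).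
Qed.

Lemma U_map1_unit (B C : X) (k : tight B C) :
  paste (row1 (ucell B)) (U_map1 k) ~= one k.
Proof.
refine (ceq_trans (paste_cong (req_refl (row1 (ucell B))) (U_map1E k))
  (ceq_trans (ufactK (L := cnil) (R := cnil) _) (ceq_sym (ccast_ceq _ _ _ _)))).
Qed.

(** Both sides are 2-cells out of two loose-identities, and on the unit in the first place each
    becomes [U_map1 k]. *)
Lemma U_map1_mul (B C : X) (k : tight B C) :
  paste (row1 (U_mult B)) (U_map1 k) ~= mul (U_map1 k) (U_map1 k).
Proof.
refine (ucell_inj (L := cnil) (R := [U B]c) _ (tidl k) (tidl k)).
refine (ceq_trans (paste_vcomp (row2 (ucell B) (idcell _)) (ceq_refl _)) _).
refine (ceq_trans (vcomp_cong (U_mult_ul B) (ceq_refl _)) _).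
refine (ceq_trans (vcomp_id _) (ceq_sym _)).
refine (ceq_trans (paste_mul (row1 (ucell B)) (row1 (idcell _)) _ _) _).
refine (ceq_trans (mul_cong (U_map1_unit k) (vcomp_id _)) (mul_1l _)).
Qed.

Lemma post_mul (B C A0 A1 A2 : X) (k : tight B C) (P : chainof X A0 A1)
    (Q : chainof X A1 A2) (f : tight A0 B) (g : tight A1 B) (h : tight A2 B)
    (Phi : cell P (U B) f g) (Psi : cell Q (U B) g h) :
  post k (mul Phi Psi) ~= mul (post k Phi) (post k Psi).
Proof.
refine (ceq_trans (postE _ _) _).
refine (ceq_trans (vcomp_cong (mulE _ _) (ceq_sym (U_map1E k))) _).
refine (ceq_trans (ceq_sym (paste_vcomp (row2 Phi Psi) (ceq_refl _))) _).
refine (ceq_trans (paste_cong (req_refl _) (U_map1_mul k)) _).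
refine (ceq_trans (paste_mul (row1 Phi) (row1 Psi) _ _) _).
apply mul_cong; apply ceq_sym, post_U_map1.
Qed.

End Transpose.

(** * Actions as natural operations on 2-cells *)

Section Action.
Context (X : virtual_equipment) (A E : X) (j t : tight A E).

Section Op.
Context (D : X) (e : tight D E) (rho : cell [hom j e]c (U E) t e).

(* The action that [rho] induces by Yoneda.  The composite [x ;; e] is named [k], as in
   [rfact], so that [op] also applies when it is only propositionally the side of [Phi]. *)
Definition op (Y : X) (x : tight Y D) (k : tight Y E) (ek : x ;; e = k)
    (P : chainof X A Y) (Phi : cell P (U E) j k) : cell P (U E) t k :=
  ccast (capp_nil P) (tidl t) ek (vcomp (factor (tidl j) ek Phi) rho).

Lemma opE (Y : X) (x : tight Y D) (k : tight Y E) (ek : x ;; e = k)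
    (P : chainof X A Y) (Phi : cell P (U E) j k) :
  op ek Phi ~= vcomp (factor (tidl j) ek Phi) rho.
Proof. apply ccast_ceq. Qed.

(** Factorizations through [hcart j e] are unique, so any [theta] over [Phi] computes [op]. *)
Lemma op_unique (Y : X) (x x' : tight Y D) (k : tight Y E) (ek : x ;; e = k)
    (P P' : chainof X A Y) (Phi : cell P (U E) j k) (a : tight A A)
    (theta : cell P' (hom j e) a x') :
  a = tid A -> x' = x -> vcomp theta (hcart j e) ~= Phi -> op ek Phi ~= vcomp theta rho.
Proof.
intros ea ex H; refine (ceq_trans (opE _ _) (vcomp_cong _ (ceq_refl _))).
apply hcart_inj; auto.
exact (ceq_trans (factorK _ _ _) (ceq_sym H)).
Qed.

(** Pasting [R] onto a factorization of [Phi] gives a factorization of [Phi'], so naturality is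
    associativity of pasting. *)
Lemma op_nat (Y Z : X) (y : tight Z Y) (x : tight Y D) (x' : tight Z D)
    (k : tight Y E) (k' : tight Z E) (ek : x ;; e = k) (ek' : x' ;; e = k')
    (P : chainof X A Y) (P' : chainof X A Z) (R : row P (tid A) y)
    (Phi : cell P (U E) j k) (Phi' : cell P' (U E) j k') :
  y ;; x = x' -> Phi' ~= paste R Phi -> op ek' Phi' ~= paste R (op ek Phi).
Proof.
intros ex H.
refine (ceq_trans _ (ceq_sym (paste_vcomp R (opE ek Phi)))).
apply op_unique; [apply tidl | exact ex |].
refine (ceq_trans (ceq_sym (paste_vcomp R _)) (ceq_sym H)).
apply ceq_sym, factorK.
Qed.

Lemma op_cong (Y : X) (x x' : tight Y D) (k k' : tight Y E) (ek : x ;; e = k)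
    (ek' : x' ;; e = k') (P P' : chainof X A Y)
    (Phi : cell P (U E) j k) (Phi' : cell P' (U E) j k') :
  x = x' -> Phi ~= Phi' -> op ek Phi ~= op ek' Phi'.
Proof.
intros ex H; refine (ceq_trans (op_unique _ _ (eq_sym ex) _) (ceq_sym (opE _ _))).
- reflexivity.
- exact (ceq_trans (factorK _ _ _) (ceq_sym H)).
Qed.

Lemma op_hcart : op (tidl e) (hcart j e) ~= rho.
Proof.
exact (ceq_trans (op_unique (tidl e) eq_refl eq_refl (vcomp_id _)) (vcomp_id _)).
Qed.

(** The hypothesis is the unit law at the universal argument [hcart j e]; it is pasted with the
    factorization of [Phi]. *)
Lemma op_unit (eta : cell cnil (U E) j t) (Y : X) (x : tight Y D) (k : tight Y E)
    (ek : x ;; e = k) (P : chainof X A Y) (Phi : cell P (U E) j k) :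
  mul eta rho ~= hcart j e -> mul eta (op ek Phi) ~= Phi.
Proof.
intros H.
refine (ceq_trans (mul_cong (ceq_sym (paste_nil_tid _)) (opE _ _)) _).
refine (ceq_trans (ceq_sym (paste_mul (rnil (tid A)) (row1 _) _ _)) _).
refine (ceq_trans (paste_cong (req_refl (row1 _)) H) (factorK (tidl j) ek Phi)).
Qed.

End Op.

(** [op rho ek (hcart j k)] is the action [rho] restricted along [x], so this replaces restricted
    actions by [rho] itself. It is naturality of [op] for the factorization of [Phi]. *)
Lemma op_op (D Y Z : X) (e : tight D E) (rho : cell [hom j e]c (U E) t e)
    (x : tight Y D) (k : tight Y E) (ek : x ;; e = k) (y : tight Z Y) (l : tight Z E)
    (el : y ;; k = l) (x' : tight Z D) (el' : x' ;; e = l)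
    (P : chainof X A Z) (Phi : cell P (U E) j l) :
  y ;; x = x' -> op (op rho ek (hcart j k)) el Phi ~= op rho el' Phi.
Proof.
intros ex; refine (ceq_trans (opE _ _ _) _).
refine (ceq_sym (op_nat rho ek el' (R := row1 (factor (tidl j) el Phi)) ex _)).
apply ceq_sym, factorK.
Qed.

(** The first hypothesis is the graded-morphism law at the universal argument; pasting it with the
    factorization of [Phi] beside [S] carries the law to every argument. *)
Lemma mul_op (D D' : X) (e : tight D E) (e' : tight D' E)
    (alpha : cell [hom j e]c (U E) t e) (beta : cell [hom j e']c (U E) t e')
    (P : chainof X D D') (eps : cell P (U E) e e')
    (Y Z : X) (x : tight Y D) (z : tight Z D') (k : tight Y E) (l : tight Z E)
    (ek : x ;; e = k) (el : z ;; e' = l) (S : row P x z)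
    (Q : chainof X A Y) (Phi : cell Q (U E) j k)
    (P' : chainof X Y Z) (eps' : cell P' (U E) k l) :
  mul alpha eps ~= op beta (tidl e') (mul (hcart j e) eps) ->
  eps' ~= paste S eps ->
  mul (op alpha ek Phi) eps' ~= op beta el (mul Phi eps').
Proof.
intros H K; pose (F := factor (tidl j) ek Phi).
refine (ceq_trans (mul_cong (opE _ _ _) K) _).
refine (ceq_trans (ceq_sym (paste_mul (row1 F) S _ _)) _).
refine (ceq_trans (paste_cong (req_refl (row_app (row1 F) S)) H) (ceq_sym _)).
apply op_nat; [apply tidr|].
refine (ceq_trans _ (ceq_sym (paste_mul (row1 F) S _ _))).
exact (mul_cong (ceq_sym (factorK _ _ _)) K).
Qed.

(* Both sides are 2-cells out of [E(j,e), D(1,1)] that agree on the unit of [D(1,1)]. *)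
Lemma mul_U_map (D : X) (e : tight D E) (rho : cell [hom j e]c (U E) t e) :
  mul rho (U_map1 e) ~= op rho (tidl e) (mul (hcart j e) (U_map1 e)).
Proof.
refine (ucell_inj (L := [hom j e]c) (R := cnil) _ eq_refl eq_refl).
refine (ceq_trans (paste_mul (row1 (idcell _)) (row1 (ucell D)) _ _) _).
refine (ceq_trans (mul_cong (vcomp_id _) (U_map1_unit e)) _).
refine (ceq_trans (mul_1r _) (ceq_trans (ceq_sym (op_hcart _)) _)).
apply op_nat; [apply tidl|].
refine (ceq_sym (ceq_trans (paste_mul (row1 (idcell _)) (row1 (ucell D)) _ _) _)).
exact (ceq_trans (mul_cong (vcomp_id _) (U_map1_unit e)) (mul_1r _)).
Qed.

(** A 2-cell in the image of [e] factors through [U_map1 e], which is graded by [mul_U_map]. *)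
Lemma mul_op_post (D : X) (e : tight D E) (rho : cell [hom j e]c (U E) t e) (Y Z : X)
    (x : tight Y D) (z : tight Z D) (k : tight Y E) (l : tight Z E)
    (ek : x ;; e = k) (el : z ;; e = l) (Q : chainof X A Y) (Phi : cell Q (U E) j k)
    (P : chainof X Y Z) (theta : cell P (U D) x z) (eps : cell P (U E) k l) :
  eps ~= post e theta -> mul (op rho ek Phi) eps ~= op rho el (mul Phi eps).
Proof.
intros H; refine (mul_op (S := row1 theta) _ _ _ (mul_U_map rho) _).
exact (ceq_trans H (post_U_map1 _ _)).
Qed.

(** Besides graded morphisms this translates the associativity law of an algebra, which says that
    the action is a graded morphism out of the monad extension on [t]. *)
Lemma tr_graded (D D' : X) (e : tight D E) (e' : tight D' E)
    (alpha : gcell [hom j e]c (hom t e)) (beta : gcell [hom j e']c (hom t e'))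
    (P : chainof X D D') (eps : gcell P (hom e e')) :
  paste (row2 alpha eps) (hom_comp t e e')
    ~= vcomp (paste (row2 (idcell (hom j e)) eps) (hom_comp j e e')) beta
  <-> mul (tr alpha) (tr eps) ~= op (tr beta) (tidl e') (mul (hcart j e) (tr eps)).
Proof.
assert (K : vcomp (vcomp (paste (row2 (idcell (hom j e)) eps) (hom_comp j e e')) beta)
              (hcart t e')
            ~= op (tr beta) (tidl e') (mul (hcart j e) (tr eps))).
{ refine (ceq_trans (ceq_sym (vcompA _ _ _)) (ceq_sym _)).
  refine (ceq_trans (op_unique _ _ (tidl _) (tidl _) _)
    (vcomp_cong (ceq_refl _) (trE beta))).
  refine (ceq_trans (hom_compE _ _) (mul_cong (vcomp_id _) _)).
  apply ceq_sym, trE. }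
split; intros H.
- refine (ceq_trans (ceq_sym (tr_hom_comp _ _)) (ceq_trans _ K)).
  exact (vcomp_cong H (ceq_refl _)).
- apply hcart_inj; try reflexivity; try (now rewrite !tidl).
  exact (ceq_trans (tr_hom_comp _ _) (ceq_trans H (ceq_sym K))).
Qed.

Lemma tr_unit (D : X) (e : tight D E) (eta : gcell cnil (hom j t))
    (alpha : gcell [hom j e]c (hom t e)) :
  vcomp alpha (hom_precomp eta e) ~= idcell (hom j e)
  <-> mul (tr eta) (tr alpha) ~= hcart j e.
Proof.
assert (K : vcomp (vcomp alpha (hom_precomp eta e)) (hcart j e)
            ~= mul (tr eta) (tr alpha)).
{ refine (ceq_trans _ (tr_hom_comp eta alpha)).
  refine (vcomp_cong _ (ceq_refl _)).
  refine (ceq_trans (pasteA (tcons (rnil (tid A)) eta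
    (tcons (row1 alpha) (idcell _) (tnil (tid D) (tid D)))) (hom_comp j t e)) _).
  exact (paste_cong (row2_cong (paste_nil_tid _) (paste_idr _)) (ceq_refl _)). }
split; intros H.
- refine (ceq_trans (ceq_sym K) (ceq_trans (vcomp_cong H (ceq_refl _)) (vcomp_id _))).
- apply hcart_inj; try reflexivity; try (now rewrite !tidl).
  exact (ceq_trans K (ceq_trans H (ceq_sym (vcomp_id _)))).
Qed.

Lemma restr_alongE (D Y : X) (e : tight D E) (alpha : gcell [hom j e]c (hom t e))
    (x : tight Y D) :
  tr (restr_along alpha x) ~= op (tr alpha) eq_refl (hcart j (x ;; e)).
Proof.
refine (ceq_trans (trE _) (ceq_trans (rfactK _ _ _) _)).
pose (F := factor (tidl j) eq_refl (hcart j (x ;; e))).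
refine (ceq_trans (ceq_sym (vcompA F alpha (hcart t e))) (ceq_sym _)).
exact (ceq_trans (opE _ _ _) (vcomp_cong (ceq_refl F) (trE alpha))).
Qed.

End Action.

(** * Limits tested on 2-cells with arbitrary left side *)

Section Limit.
Context (X : virtual_equipment) (Y Z W : X) (p : loose Y Z) (f : tight Y W).

Lemma cone_compE (c : cone p f) (Q : chainof X W Z)
    (phi : gcell Q (hom (tid W) (cone_pt c))) (chi : gcell (Q +++ [p]c) (hom (tid W) f)) :
  paste (row2 phi (cone_cell c)) (hom_comp (tid W) (cone_pt c) f) ~= chi
  <-> mul (tr phi) (tr (cone_cell c)) = tr chi.
Proof.
split; intros H.
- apply ceq_eq, (ceq_trans (ceq_sym (tr_hom_comp _ _))).
  exact (ceq_trans (vcomp_cong H (ceq_refl _)) (ceq_sym (trE _))).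
- apply hcart_inj; try reflexivity; try apply tidl.
  refine (ceq_trans (tr_hom_comp _ _) _); rewrite H; apply trE.
Qed.

Lemma is_limit_tr (c : cone p f) :
  is_limit c <->
  forall (Q : chainof X W Z) (Chi : cell (Q +++ [p]c) (U W) (tid W) f),
  exists! Phi : cell Q (U W) (tid W) (cone_pt c), mul Phi (tr (cone_cell c)) = Chi.
Proof.
split; intros H Q chi.
- destruct (H Q (untr chi)) as [phi [H1 H2]]; exists (tr phi); split.
  + apply cone_compE in H1; now rewrite untrK in H1.
  + intros Psi K; rewrite (H2 (untr Psi)), untrK; [reflexivity|].
    apply cone_compE; now rewrite !untrK.
- destruct (H Q (tr chi)) as [Phi [H1 H2]]; exists (untr Phi); split.
  + apply cone_compE; now rewrite untrK.
  + intros psi K; apply cone_compE in K.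
    now rewrite (H2 _ K), trK.
Qed.

Section LeftSide.
Context (c : cone p f) (lim : is_limit c).
Context (A0 : X) (s : tight A0 W) (Q : chainof X A0 Z).
Let mu := tr (cone_cell c).

(* The left side [s] is moved into the chain as the loose-cell [W(1,s)]: pasting with
   [companion_row] undoes [mul (hcart (tid W) s)]. *)
Let companion_row : row (hom (tid W) s ::c Q) s (tid Z) :=
  rcons (factor (tidr s) (tidl s) (one s)) (id_row Q).

Let slide (Phi : cell (hom (tid W) s ::c Q) (U W) (tid W) (cone_pt c)) :
    cell Q (U W) s (cone_pt c) :=
  ccast (row_top_id Q) (tidr s) (tidl _) (paste companion_row Phi).

(** The limit factors the product of [hcart (tid W) s] with [Chi]; [slide] then turns the leading
    [hcart] into the unit [one s]. *)
Lemma limit_ex (Chi : cell (Q +++ [p]c) (U W) s f) :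
  exists Phi : cell Q (U W) s (cone_pt c), mul Phi mu = Chi.
Proof.
destruct (proj1 (is_limit_tr c) lim (hom (tid W) s ::c Q)
  (mul (hcart (tid W) s) Chi)) as [Phi [H _]].
exists (slide Phi); apply ceq_eq.
refine (ceq_trans (mul_cong (ccast_ceq _ _ _ _) (ceq_sym (vcomp_id _))) _).
refine (ceq_trans (ceq_sym (paste_mul companion_row (row1 (idcell p)) _ _)) _).
fold mu in H; rewrite H.
refine (ceq_trans _ (ceq_trans (paste_mul (row1 (factor (tidr s) (tidl s) (one s)))
  (id_row (Q +++ [p]c)) (hcart (tid W) s) Chi) _)).
- rewrite id_row_app; apply ceq_refl.
- refine (ceq_trans (mul_cong (factorK _ _ _) (paste_idl _)) (mul_1l _)).
Qed.

(** Multiplication by [hcart (tid W) s] has [slide] as a left inverse, which reduces the claim to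
    uniqueness of factorizations with left side [tid W]. *)
Lemma limit_inj (Phi Psi : cell Q (U W) s (cone_pt c)) :
  mul Phi mu ~= mul Psi mu -> Phi = Psi.
Proof.
intros H.
assert (K : forall Theta : cell Q (U W) s (cone_pt c),
  slide (mul (hcart (tid W) s) Theta) = Theta).
{ intros Theta; apply ceq_eq, (ceq_trans (ccast_ceq _ _ _ _)).
  refine (ceq_trans (paste_mul (row1 (factor (tidr s) (tidl s) (one s)))
    (id_row Q) (hcart (tid W) s) Theta) _).
  refine (ceq_trans (mul_cong (factorK _ _ _) (paste_idl _)) (mul_1l _)). }
rewrite <- (K Phi), <- (K Psi); f_equal.
destruct (proj1 (is_limit_tr c) lim (hom (tid W) s ::c Q)
  (mul (mul (hcart (tid W) s) Phi) mu)) as [Theta [_ H2]].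
transitivity Theta; [symmetry|]; apply H2; [reflexivity|].
apply ceq_eq, (ceq_trans (mulA (hcart (tid W) s) Psi mu)).
refine (ceq_trans (mul_cong (ceq_refl _) (ceq_sym H)) _).
exact (ceq_sym (mulA (hcart (tid W) s) Phi mu)).
Qed.

End LeftSide.
End Limit.

(** * Algebras in transposed form, and the algebra on a limit *)

Section Algebras.
Context (X : virtual_equipment) (A E : X) (j : tight A E) (T : relative_monad j).

Lemma alg_unit_tr (D : X) (a : algebra T D) :
  mul (tr (rm_unit T)) (tr (alg_act a)) ~= hcart j (alg_e a).
Proof. apply tr_unit, alg_unit. Qed.

Lemma alg_assoc_tr (D : X) (a : algebra T D) :
  mul (tr (rm_ext T)) (tr (alg_act a))
  ~= op (tr (alg_act a)) (tidl _) (mul (hcart j (rm_t T)) (tr (alg_act a))).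
Proof. apply tr_graded, alg_assoc. Qed.

(** Kept transparent, so that [alg_e] and [alg_act] of the result reduce in later proofs. *)
Definition algebra_of (D : X) (e : tight D E) (rho : cell [hom j e]c (U E) (rm_t T) e)
    (unit : mul (tr (rm_unit T)) rho ~= hcart j e)
    (assoc : mul (tr (rm_ext T)) rho
             ~= op rho (tidl e) (mul (hcart j (rm_t T)) rho)) : algebra T D.
Proof.
refine {| alg_e := e; alg_act := untr rho |}.
- apply tr_unit; now rewrite untrK.
- apply tr_graded; now rewrite untrK.
Defined.

(** [tr (rm_ext T)] is its own operation at the universal argument, and associativity makes the
    action graded over it; [mul_op] carries this to [Phi]. *)
Lemma op_assoc (D : X) (a : algebra T D) (Y : X) (x : tight Y D) (k : tight Y E)
    (ek : x ;; alg_e a = k) (P : chainof X A Y) (Phi : cell P (U E) j k) :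
  let rho := tr (alg_act a) in
  mul (tr (rm_ext T)) (op rho ek Phi)
  ~= op rho ek (mul (hcart j (rm_t T)) (op rho ek Phi)).
Proof.
intros rho.
refine (ceq_trans (mul_cong (ceq_sym (op_hcart _)) (ceq_refl _)) _).
exact (mul_op (S := row1 (factor (tidl j) ek Phi)) (tidl _) ek _ (alg_assoc_tr a)
  (opE _ _ _)).
Qed.

Definition alg_restr (D Y : X) (a : algebra T D) (x : tight Y D) : algebra T Y.
Proof.
pose (rho := tr (alg_act a)).
refine (@algebra_of Y (x ;; alg_e a)
  (op rho eq_refl (hcart j (x ;; alg_e a))) _ _).
- apply op_unit, alg_unit_tr.
- refine (ceq_trans (op_assoc _ _) (ceq_sym (op_op _ _ _ _ _ _))); apply tidl.
Defined.

Lemma restr_along_alg (D Y : X) (a : algebra T D) (x : tight Y D) :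
  restr_along (alg_act a) x = alg_act (alg_restr a x).
Proof.
apply tr_inj; simpl; rewrite untrK; apply ceq_eq, restr_alongE.
Qed.

Section LimitAlgebra.
Context (Y Z : X) (p : loose Y Z) (a : algebra T Y) (c : cone p (alg_e a)).
Context (lim : is_limit c).
Let mu := tr (cone_cell c).
Let sigma := tr (alg_act a).

(** The third equation defines [rho] by factorization through [mu]; cancelling [mu] reduces the
    other two to the laws of [a]. *)
Lemma limit_action :
  exists rho : cell [hom j (cone_pt c)]c (U E) (rm_t T) (cone_pt c),
    mul (tr (rm_unit T)) rho ~= hcart j (cone_pt c) /\
    mul (tr (rm_ext T)) rho ~= op rho (tidl _) (mul (hcart j (rm_t T)) rho) /\
    mul rho mu ~= op sigma (tidl _) (mul (hcart j (cone_pt c)) mu).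
Proof.
destruct (limit_ex lim (Q := [hom j (cone_pt c)]c)
  (op sigma (tidl _) (mul (hcart j (cone_pt c)) mu))) as [rho H].
(* Naturality extends the defining equation of [rho] from the universal argument to every
   argument. *)
assert (G : forall (P : chainof X A Z) (Phi : cell P (U E) j (cone_pt c)),
  mul (op rho (tidl _) Phi) mu ~= op sigma (tidl _) (mul Phi mu)).
{ intros P Phi; refine (mul_op (S := id_row [p]c) _ _ _ (ceq_of_eq H) _).
  apply ceq_sym, paste_idl. }
exists rho; split; [|split].
- apply ceq_of_eq, (limit_inj lim).
  refine (ceq_trans (mulA (tr (rm_unit T)) rho mu) _).
  refine (ceq_trans (mul_cong (ceq_refl _) (ceq_of_eq H)) _).
  apply op_unit, alg_unit_tr.
- apply ceq_of_eq, (limit_inj lim).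
  refine (ceq_trans (mulA (tr (rm_ext T)) rho mu) _).
  refine (ceq_trans (mul_cong (ceq_refl _) (ceq_of_eq H)) _).
  refine (ceq_trans (op_assoc _ _) (ceq_sym _)).
  refine (ceq_trans (G _ _) (op_cong _ _ _ eq_refl _)).
  exact (ceq_trans (mulA (hcart j (rm_t T)) rho mu)
    (mul_cong (ceq_refl _) (ceq_of_eq H))).
- exact (ceq_of_eq H).
Qed.

End LimitAlgebra.
End Algebras.

(** * Algebra objects and creation of limits *)

Section AlgebraObject.
Context (X : virtual_equipment) (A E : X) (j : tight A E) (T : relative_monad j).
Context (M : algebra_object T).
Let u := ao_u M.
Let rho := tr (alg_act (ao_alg M)).

(** [x] itself meets the conditions that characterize the lift of the restricted algebra. *)
Lemma ao_lift_restr (D : X) (x : tight D (Alg M)) :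
  ao_lift M (alg_restr (ao_alg M) x) = x.
Proof.
symmetry; apply ao_lift_unique; [reflexivity|].
apply ceq_of_eq, restr_along_alg.
Qed.

(** The hypothesis is the graded-morphism law between the algebras restricted along [x] and [y]. *)
Lemma ao_full (D D' : X) (P : chainof X D D') (x : tight D (Alg M))
    (y : tight D' (Alg M)) (eps : cell P (U E) (x ;; u) (y ;; u)) :
  mul (op rho eq_refl (hcart j (x ;; u))) eps
    ~= op rho eq_refl (mul (hcart j (x ;; u)) eps) ->
  exists! theta : cell P (U (Alg M)) x y, post u theta = eps.
Proof.
intros H.
assert (G : graded_morphism (a := alg_restr (ao_alg M) x) (a' := alg_restr (ao_alg M) y)
              (untr eps)).
{ apply tr_graded; simpl; rewrite !untrK.
  refine (ceq_trans H (ceq_sym (op_op _ _ _ _ _ _))); apply tidl. }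
(* The restricted algebras lift to [x] and [y] again, which gives [theta] the required sides. *)
pose proof (ao_lift_cell M G) as K; rewrite !ao_lift_restr in K.
destruct K as [theta [K1 K2]]; exists (tr theta); split.
- apply (whisker_eq theta _ eq_refl eq_refl) in K1; rewrite untrK in K1.
  exact (ceq_eq K1).
- intros theta' K; rewrite (K2 (untr theta')), untrK; [reflexivity|].
  apply (whisker_eq _ _ eq_refl eq_refl); rewrite !untrK; exact (ceq_of_eq K).
Qed.

Lemma mul_op_whisker (Y Z : X) (x : tight Y (Alg M)) (z : tight Z (Alg M)) (k : tight Y E)
    (ek : x ;; u = k) (Q : chainof X A Y) (Phi : cell Q (U E) j k)
    (P : chainof X Y Z) (theta : cell P (U (Alg M)) x z) (eps : cell P (U E) k (z ;; u)) :
  eps ~= post u theta -> mul (op rho ek Phi) eps ~= op rho eq_refl (mul Phi eps).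
Proof. apply mul_op_post. Qed.

(** Uniqueness of lifts, for the algebra restricted along [y]. In the hypothesis, which compares two
    restricted actions, [x] enters only through [exy]. *)
Lemma restr_along_eq (D : X) (x y : tight D (Alg M)) (exy : x ;; u = y ;; u) :
  op rho exy (hcart j (y ;; u)) ~= op rho eq_refl (hcart j (y ;; u)) -> x = y.
Proof.
intros H; rewrite <- (ao_lift_restr y).
apply ao_lift_unique; [exact exy|].
rewrite <- restr_along_alg.
apply hcart_inj; try reflexivity; try exact exy.
refine (ceq_trans (ceq_sym (trE _)) (ceq_trans _ (trE _))).
refine (ceq_trans (restr_alongE _ _) (ceq_sym (ceq_trans (restr_alongE _ _) _))).
refine (ceq_trans (ceq_sym H) (op_cong _ _ _ eq_refl (hcart_cong eq_refl (eq_sym exy)))).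
Qed.

Section Creation.
Context (Y Z : X) (p : loose Y Z) (f : tight Y (Alg M)).

(** [w] is the lift of the limit algebra; the equation says that the limiting cone is graded for the
    action restricted along [w]. *)
Lemma limit_apex (c : cone p (f ;; u)) : is_limit c ->
  exists (w : tight Z (Alg M)) (ew : w ;; u = cone_pt c),
    mul (op rho ew (hcart j (cone_pt c))) (tr (cone_cell c))
    ~= op rho eq_refl (mul (hcart j (cone_pt c)) (tr (cone_cell c))).
Proof.
intros lim.
destruct (limit_action (a := alg_restr (ao_alg M) f) (c := c) lim)
  as (sigma & H1 & H2 & H3).
pose (b := algebra_of H1 H2).
exists (ao_lift M b), (ao_lift_e M b).
refine (ceq_trans (mul_cong _ (ceq_refl _)) (ceq_trans H3 _)).
(* By [ao_lift_act], the action restricted along [w] is the action [sigma] of [b]. *)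
- pose proof (ao_lift_act M b) as K.
  refine (ceq_trans _ (ceq_trans (vcomp_cong K
    (hcart_cong eq_refl (ao_lift_e M b))) _)).
  + refine (ceq_trans _ (ceq_trans (ceq_sym (restr_alongE _ _)) (trE _))).
    exact (op_cong _ _ _ eq_refl (hcart_cong eq_refl (eq_sym (ao_lift_e M b)))).
  + exact (factorK _ _ _).
- simpl; rewrite untrK; apply op_op, tidl.
Qed.

Context (w : tight Z (Alg M)) (mu : gcell [p]c (hom (w ;; u) (f ;; u))).
Let c := Build_cone mu.
Context (lim : is_limit c) (theta : cell [p]c (U (Alg M)) w f).
Context (thetaE : post u theta = tr mu).

(** Multiplied by [tr mu], both sides become [op rho] at the product of [hcart] with [post u Chi],
    since [post u Chi] and [tr mu] are images under [u] and hence graded. The limit then cancels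
    [tr mu]. *)
Lemma graded_of_limit (Q : chainof X (Alg M) Z) (Psi : cell Q (U E) (tid _ ;; u) (w ;; u))
    (Chi : cell (Q +++ [p]c) (U (Alg M)) (tid _) f) :
  mul Psi (tr mu) = post u Chi ->
  mul (op rho eq_refl (hcart j (tid _ ;; u))) Psi
  ~= op rho eq_refl (mul (hcart j (tid _ ;; u)) Psi).
Proof.
intros H; apply ceq_of_eq, (limit_inj lim (Q := hom j (tid _ ;; u) ::c Q)).
refine (ceq_trans (mulA (op rho eq_refl (hcart j (tid _ ;; u))) Psi (tr mu)) _).
refine (ceq_trans (mul_cong (ceq_refl _) (ceq_of_eq H)) _).
refine (ceq_trans (mul_op_whisker eq_refl _ (ceq_refl _)) (ceq_sym _)).
refine (ceq_trans (mul_op_whisker eq_refl _ (ceq_sym (ceq_of_eq thetaE))) _).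
refine (op_cong _ _ _ eq_refl _).
exact (ceq_trans (mulA (hcart j (tid _ ;; u)) Psi (tr mu))
  (mul_cong (ceq_refl _) (ceq_of_eq H))).
Qed.

Lemma created_is_limit : is_limit (Build_cone (untr theta)).
Proof.
apply is_limit_tr; simpl; intros Q Chi; rewrite untrK.
destruct (limit_ex lim (post u Chi)) as [Psi HPsi]; simpl in Psi, HPsi.
destruct (ao_full (graded_of_limit HPsi)) as [Phi [H1 H2]].
exists Phi; split.
(* The product of [Phi] with [theta] has the same image under [u] as [Chi], and the uniqueness in
   [ao_full] equates them. *)
- destruct (ao_full (x := tid _) (y := f) (eps := post u Chi)
    (mul_op_whisker eq_refl _ (ceq_refl _))) as [Chi' [_ K]].
  transitivity Chi'; [symmetry|]; apply K; [|reflexivity].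
  apply ceq_eq, (ceq_trans (post_mul _ _ _)).
  refine (ceq_trans (mul_cong (ceq_of_eq H1) (ceq_of_eq thetaE)) (ceq_of_eq HPsi)).
(* The image under [u] of any other factorization of [Chi] is a factorization of [post u Chi]
   through the limit, hence is [Psi]. *)
- intros Phi' K; apply H2, (limit_inj lim).
  refine (ceq_trans _ (ceq_of_eq (eq_sym HPsi))); rewrite <- K.
  refine (ceq_trans (mul_cong (ceq_refl _) (ceq_of_eq (eq_sym thetaE))) _).
  apply ceq_sym, post_mul.
Qed.

End Creation.
End AlgebraObject.

Theorem proposition3p6 (X : virtual_equipment) (A E : X) (j : tight A E)
  (T : relative_monad j) (M : algebra_object T) :
  strictly_creates_limits (ao_u M).
Proof.
intros Y Z p f c lim.
destruct (limit_apex lim) as (w & ew & graded).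
(* With the apex replaced by [w ;; u], the 2-cell [mu] has sides of the form that [ao_full]
   expects. *)
destruct c as [x mu]; simpl in *; subst x.
destruct (ao_full graded) as [theta [thetaE theta_unique]].
exists (Build_cone (untr theta)); split; [split; [split; [reflexivity|]|]|].
- apply whisker_eq; try reflexivity.
  simpl; rewrite untrK; exact (ceq_of_eq thetaE).
- intros [w' mu'] [ew' Hmu']; simpl in *.
  apply (whisker_eq (f := w') (g := f) mu' mu ew' eq_refl) in Hmu'.
  (* [mu] is graded for the actions restricted along [w] and along [w'], so cancelling [mu] equates
     these actions. *)
  assert (e : w' = w).
  { apply (restr_along_eq (exy := ew')), ceq_of_eq, (limit_inj lim).
    refine (ceq_trans (mul_op_whisker ew' _ (ceq_sym Hmu')) (ceq_sym _)).
    exact (mul_op_whisker eq_refl _ (ceq_sym (ceq_of_eq thetaE))). }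
  subst w'; f_equal.
  rewrite (theta_unique (tr mu') (ceq_eq Hmu')); apply trK.
- exact (created_is_limit lim thetaE).
Qed.
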